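(* Let $\mathcal{R} = ((M, G, \triangleright), (m_0, \{g_{m_0,m}\}_{m \in M}))$ be a finitely right generated cell space such that the stabiliser $G_0$ of $m_0$ under $\triangleright$ is finite, and let $S$ be a finite and symmetric right generating set of $\mathcal{R}$. Let $\{F_i\}_{i \in I}$ be a net in $\{F \subseteq M : F \ne \emptyset, F \text{ finite}\}$ indexed by a directed set $(I, \le)$. It is a right F\o lner net in $\mathcal{R}$ if and only if $$\forall \rho \in \mathbb{N}_0 : \quad \lim_{i \in I} \frac{|\partial_\rho F_i|}{|F_i|} = 0.$$
   Context: A \emph{left homogeneous space} is a triple $(M, G, \triangleright)$ where $M$ is a non-empty set, $G$ is a group, and $\triangleright : G \times M \to M$ is a transitive left group action. A \emph{coordinate system} for it is a tuple $(m_0, \{g_{m_0,m}\}_{m\in M})$ with $m_0 \in M$, $g_{m_0,m} \in G$ and $g_{m_0,m} \triangleright m_0 = m$ for each $m \in M$. A left homogeneous space together with a coordinate system is a \emph{cell space}. $G_0$ is the stabiliser of $m_0$, and $G/G_0$ is the set of left cosets $gG_0$, on which $G$ (hence $G_0$) acts by left multiplication, $g \cdot g'G_0 = gg'G_0$. The cell space induces the map $\trianglelefteq : M \times G/G_0 \to M$, $m \trianglelefteq gG_0 = g_{m_0,m}\, g\, g_{m_0,m}^{-1} \triangleright m = g_{m_0,m}\, g \triangleright m_0$. \textbf{Right generating sets.} Let $S \subseteq G/G_0$ with $G_0 \cdot S \subseteq S$. Put $S^{-1} = \{g^{-1}G_0 : s \in S, g \in s\}$. $S$ is a \emph{right generating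 set} of $\mathcal{R}$ if for each $m \in M$ there are $k \in \mathbb{N}_0$ and $s_1, \dots, s_k \in S \cup S^{-1}$ with $(((m_0 \trianglelefteq s_1) \trianglelefteq s_2) \trianglelefteq \cdots) \trianglelefteq s_k = m$. It is \emph{symmetric} if $S^{-1} \subseteq S$. $\mathcal{R}$ is \emph{finitely right generated} if it has a finite right generating set. \textbf{Balls and boundaries.} The $S$-metric is $d_S(m,m') = \min\{k \in \mathbb{N}_0 : \exists s_1,\dots,s_k \in S,\ (((m \trianglelefteq s_1) \trianglelefteq s_2) \trianglelefteq \cdots) \trianglelefteq s_k = m'\}$ and $\mathbb{B}_S(\theta) = \{m \in M : d_S(m_0,m) \le \theta\}$. $M$ is identified with $G/G_0$ by the bijection $m \mapsto G_{m_0,m} = \{g \in G : g \triangleright m_0 = m\}$, so that $m \trianglelefteq \mathbb{B}_S(\theta) = \{m \trianglelefteq G_{m_0,m'} : m' \in \mathbb{B}_S(\theta)\}$. For $A \subseteq M$ and $\theta \in \mathbb{N}_0$: $A^{-\theta} = \{m \in M : m \trianglelefteq \mathbb{B}_S(\theta) \subseteq A\}$, $A^{+\theta} = \{m \in M : (m \trianglelefteq \mathbb{B}_S(\theta)) \cap A \ne \emptyset\}$, and the \emph{$\theta$-boundary} is $\partial_\theta A = A^{+\theta} \setminus A^{-\theta}$. \textbf{Right F\o lner nets.} A net $\{F_i\}_{i \in I}$ of non-empty finite subsets of $M$ indexed by a directed set $(I,\le)$ is a \emph{right F\o lner net in $\mathcal{R}$} if for each $\mathfrak{g} \in G/G_0$,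 $\lim_{i \in I} \frac{|F_i \setminus (\_ \trianglelefteq \mathfrak{g})^{-1}(F_i)|}{|F_i|} = 0$, where $\_ \trianglelefteq \mathfrak{g}$ is the map $M \to M$, $m \mapsto m \trianglelefteq \mathfrak{g}$. *)

(* Defs.v *)
From HB Require Import structures.
From mathcomp Require Import all_boot all_order all_algebra finmap.
From mathcomp Require Import all_classical all_reals all_analysis.
Import GRing.Theory Num.Theory.
Import numFieldNormedType.Exports.
Set Implicit Arguments.
Unset Strict Implicit.
Unset Printing Implicit Defensive.

Local Open Scope classical_set_scope.
Local Open Scope group_scope.

(* Neither [choiceType] nor [groupType] (whose carrier is a [choiceType])
   restricts [M] and [G]: classically every type has a choice operator. *)
Record left_homogeneous_space (M : choiceType) (G : groupType) := {
  act : G -> M -> M;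
  space_nonempty : [set: M] !=set0;
  act1 : forall m, act 1 m = m;
  actM : forall g h m, act (g * h) m = act g (act h m);
  act_transitive : forall m m', exists g, act g m = m'
}.

Record coordinate_system (M : choiceType) (G : groupType)
    (H : left_homogeneous_space M G) := {
  origin : M;
  coord : M -> G;
  coordP : forall m, act H (coord m) origin = m
}.

Record cell_space (M : choiceType) (G : groupType) := {
  cell_homogeneous :> left_homogeneous_space M G;
  cell_coordinates :> coordinate_system cell_homogeneous
}.

Section CellSpace.
Context {M : choiceType} {G : groupType}.
Variable R : cell_space M G.
Implicit Types (m : M) (g h : G).

Local Notation "g |> m" := (act R g m) (at level 45, right associativity).
Local Notation m0 := (origin R).
Local Notation "'g_' m" := (coord R m) (at level 8, m at level 2).

Definition stab : set G := [set g | g |> m0 = m0].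

Definition lcoset g : set G := [set g * h | h in stab].

(* The type G/G_0: its elements are the subsets g G_0 of G. *)
Definition quot : Type := set_type (range lcoset).

Definition coset g : quot := SigSub (mem_set (imageT lcoset g)).

Definition repr (c : quot) : G := xget 1 (val c).

(* [coset_actE], [ractE]: independence of the representative. *)
Definition coset_act g (c : quot) : quot := coset (g * repr c).

Definition ract m (c : quot) : M := (g_ m * repr c * (g_ m)^-1) |> m.

Lemma actKV g m : g^-1 |> (g |> m) = m.
Proof. by rewrite -actM mulVg act1. Qed.

Lemma lcosetP g h : lcoset g h <-> h |> m0 = g |> m0.
Proof.
split=> [[k k0 <-]|e]; first by rewrite actM k0.
exists (g^-1 * h); last by rewrite mulVKg.
by rewrite /stab /= actM e actKV.
Qed.

Lemma lcoset_eq g h : lcoset g = lcoset h <-> g |> m0 = h |> m0.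
Proof.
split=> [e|e]; first by apply/lcosetP; rewrite -e; apply/lcosetP.
by apply/seteqP; split=> k /lcosetP ek; apply/lcosetP; rewrite ek.
Qed.

Lemma coset_eq g h : coset g = coset h <-> g |> m0 = h |> m0.
Proof.
split=> [e|e]; last by apply/val_inj/lcoset_eq.
by apply/lcoset_eq; exact: (congr1 val e).
Qed.

Lemma cosetS (c : quot) : exists g, c = coset g.
Proof.
case: c => A Ac; have /set_mem [g _ gA] := Ac.
by exists g; apply/val_inj.
Qed.

Lemma repr_coset g : repr (coset g) |> m0 = g |> m0.
Proof.
apply/lcosetP; rewrite /repr; apply: (@xgetPex _ _ (lcoset g)).
by exists g; apply/lcosetP.
Qed.

Lemma reprK (c : quot) : coset (repr c) = c.
Proof. by have [g ->] := cosetS c; apply/coset_eq/repr_coset. Qed.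

Lemma coset_actE g h : coset_act g (coset h) = coset (g * h).
Proof. by apply/coset_eq; rewrite !actM repr_coset. Qed.

Lemma act_coordV m : (g_ m)^-1 |> m = m0.
Proof. by rewrite -{2}(coordP R m) actKV. Qed.

Lemma ract_coset m g : ract m (coset g) = (g_ m * g) |> m0.
Proof. by rewrite /ract !actM act_coordV repr_coset. Qed.

Lemma ractE m g : ract m (coset g) = (g_ m * g * (g_ m)^-1) |> m.
Proof. by rewrite ract_coset !actM act_coordV. Qed.

Definition stab_stable (S : set quot) : Prop :=
  forall g c, stab g -> S c -> S (coset_act g c).

Definition quot_inv (S : set quot) : set quot :=
  [set c | exists2 s, S s & exists2 g, val s g & c = coset g^-1].

(* [walk S k m m'] : m' = (((m <| s_1) <| s_2) ...) <| s_k with s_i in S. *)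
Definition walk (S : set quot) (k : nat) m m' : Prop :=
  exists s : k.-tuple quot, [set` s] `<=` S /\ foldl ract m s = m'.

Definition right_generating (S : set quot) : Prop :=
  stab_stable S /\ forall m, exists k, walk (S `|` quot_inv S) k m0 m.

Definition symmetric_set (S : set quot) : Prop := quot_inv S `<=` S.

Definition finitely_right_generated : Prop :=
  exists2 S, finite_set S & right_generating S.

(* The minimum of the k with [walk S k m m'] (see [S_metricP]); 0 is an
   irrelevant default for when no such k exists, which does not happen if S is
   a symmetric right generating set (see [walk_connected]). *)
Definition S_metric (S : set quot) m m' : nat :=
  xget 0%N [set k | walk S k m m' /\ forall j, walk S j m m' -> (k <= j)%N].

Definition ball (S : set quot) (theta : nat) : set M :=
  [set m | (S_metric S m0 m <= theta)%N].

Lemma transporter_coset m : range lcoset [set g | g |> m0 = m].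
Proof.
exists (g_ m) => //; apply/seteqP.
by split=> g /=; rewrite lcosetP coordP.
Qed.

(* The element G_{m_0,m} of G/G_0 that is identified with m. *)
Definition transporter m : quot := SigSub (mem_set (transporter_coset m)).

Definition translate m (A : set M) : set M :=
  [set ract m (transporter m') | m' in A].

Definition erosion (S : set quot) (theta : nat) (A : set M) : set M :=
  [set m | translate m (ball S theta) `<=` A].

Definition dilation (S : set quot) (theta : nat) (A : set M) : set M :=
  [set m | translate m (ball S theta) `&` A !=set0].

Definition boundary (S : set quot) (theta : nat) (A : set M) : set M :=
  dilation S theta A `\` erosion S theta A.

Lemma S_metricP (S : set quot) m m' : (exists k, walk S k m m') ->
  walk S (S_metric S m m') m m' /\
  forall j, walk S j m m' -> (S_metric S m m' <= j)%N.
Proof.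
move=> [k wk]; rewrite /S_metric; set P := mkset _.
suff : P (xget 0%N P) by [].
apply: xgetPex; have exP : exists j, `[< walk S j m m' >].
  by exists k; apply/asboolP.
have [j /asboolP wj minj] := ex_minnP exP.
by exists j; split=> // i wi; apply: minj; apply/asboolP.
Qed.

Lemma walk0 S m : walk S 0 m m.
Proof. by exists [tuple]; split=> // c; rewrite /= in_nil. Qed.

Lemma walk_rcons S k m m' c : walk S k m m' -> S c ->
  walk S k.+1 m (ract m' c).
Proof.
move=> [s [sS <-]] Sc; exists [tuple of rcons s c].
split=> [x|] /=; last by rewrite foldl_rcons.
by rewrite mem_rcons inE => /orP[/eqP ->//|xs]; exact: sS.
Qed.

Lemma walk_last S k m m' : walk S k.+1 m m' ->
  exists m'' c, [/\ walk S k m m'', S c & m' = ract m'' c].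
Proof.
move=> [[s sz] [/= sS <-]].
have {}sS x : x \in s -> S x by exact: sS.
move/eqP: sz sS; case: (lastP s) => // {}s c.
rewrite size_rcons => -[ek] sS.
exists (foldl ract m s), c; split.
- exists (Tuple (introT eqP ek)); split=> //= y /= ys.
  by apply: sS => /=; rewrite mem_rcons inE ys orbT.
- by apply: sS => /=; rewrite mem_rcons inE eqxx.
- by rewrite foldl_rcons.
Qed.

Lemma walk_cat S j k a b c : walk S j a b -> walk S k b c ->
  walk S (j + k) a c.
Proof.
move=> wab; elim: k c => [|k IH] c.
  by rewrite addn0 => -[s [_ <-]]; rewrite tuple0.
by move=> /walk_last[m' [x [/IH w Sx ->]]]; rewrite addnS; exact: walk_rcons.
Qed.

Lemma ract_equiv m g (c : quot) :
  exists2 h, stab h & g |> ract m c = ract (g |> m) (coset_act h c).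
Proof.
exists ((g_ (g |> m))^-1 * g * g_ m).
  by rewrite /stab /= !actM coordP act_coordV.
have [k ->] := cosetS c; rewrite coset_actE !ract_coset -actM.
by rewrite !mulgA mulgV mul1g.
Qed.

Lemma walk_equiv S k m m' g : stab_stable S -> walk S k m m' ->
  walk S k (g |> m) (g |> m').
Proof.
move=> stS; elim: k m' => [|k IH] m'.
  by move=> [s [_ <-]]; rewrite tuple0; exact: walk0.
move=> /walk_last[m'' [c [/IH w Sc ->]]].
by have [h h0 ->] := ract_equiv m'' g c; apply: walk_rcons w _; exact: stS.
Qed.

Lemma walk_connected S m m' : right_generating S -> symmetric_set S ->
  exists k, walk S k m m'.
Proof.
move=> [stS gen] sym; have SV : S `|` quot_inv S = S by apply/setUidPl.
have [k wk] := gen ((g_ m)^-1 |> m'); exists k.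
move: wk; rewrite SV => /(walk_equiv (g_ m) stS).
by rewrite coordP -actM mulgV act1.
Qed.

Lemma walk_translate S k m m' : stab_stable S -> walk S k m0 m' ->
  walk S k m (ract m (transporter m')).
Proof.
move=> stS /(walk_equiv (g_ m) stS); rewrite coordP.
have -> : transporter m' = coset (g_ m').
  by apply: val_inj; apply/seteqP; split=> g /=; rewrite lcosetP coordP.
by rewrite ract_coset actM coordP.
Qed.

Lemma walk_sym S k m m' : stab_stable S -> symmetric_set S ->
  walk S k m m' -> walk S k m' m.
Proof.
move=> stS sym; elim: k m' => [|k IH] m'.
  by move=> [s [_ <-]]; rewrite tuple0; exact: walk0.
move=> /walk_last[m'' [c [/IH w Sc ->]]]; rewrite -add1n.
apply: walk_cat w; have [g cg] := cosetS c.
pose h := (g_ (ract m'' c))^-1 * g_ m'' * g.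
have h0 : stab h by rewrite /stab /= /h -mulgA actM -ract_coset -cg act_coordV.
have e : m'' = ract (ract m'' c) (coset_act h (coset g^-1)).
  by rewrite coset_actE ract_coset /h !mulgA mulgV mul1g mulgK coordP.
rewrite [X in walk _ _ _ X]e; apply: walk_rcons (walk0 _ _) _; apply: (stS _ _ h0); apply: sym.
by exists c => //; exists g => //; rewrite cg; apply/lcosetP.
Qed.

Lemma walk_finite S k m : finite_set S -> finite_set [set m' | walk S k m m'].
Proof.
move=> finS; elim: k => [|k IH].
  apply: sub_finite_set (finite_set1 m).
  by move=> _ [s [_ <-]]; rewrite tuple0.
apply: sub_finite_set (finite_image2 ract IH finS).
by move=> m' /walk_last[m'' [c [w Sc ->]]]; exists m'' => //; exists c.
Qed.

(* So [setcard] below is the true cardinality of the boundaries of finite sets. *)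
Lemma boundary_finite S theta A :
  finite_set S -> right_generating S -> symmetric_set S -> finite_set A ->
  finite_set (boundary S theta A).
Proof.
move=> finS genS symS finA; have stS := genS.1.
apply: (@sub_finite_set _ _
  (\bigcup_(k in `I_theta.+1) \bigcup_(a in A) [set m | walk S k a m])); last first.
  apply: bigcup_finite => [|k _]; first exact: finite_II.
  by apply: bigcup_finite => // a _; exact: walk_finite.
move=> m [[_ [[m' m'B <-] Am]] _].
have [w _] := S_metricP (walk_connected m0 m' genS symS).
exists (S_metric S m0 m'); first by rewrite /= ltnS.
exists (ract m (transporter m')) => //.
by apply: walk_sym => //; exact: walk_translate.
Qed.

End CellSpace.

Record directed_set (I : Type) (le : I -> I -> Prop) : Prop := {
  directed_inhabited : [set: I] !=set0;
  directed_refl : forall i, le i i;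
  directed_trans : forall i j k, le i j -> le j k -> le i k;
  directed_ub : forall i j, exists2 k, le i k & le j k
}.

(* Generated by the tails of the net: lim_{i in I} x_i = l is
   [x @ net_filter le --> l]. *)
Definition net_filter (I : Type) (le : I -> I -> Prop) : set_system I :=
  filter_from [set: I] (fun i0 => [set i | le i0 i]).

Lemma net_filter_proper (I : Type) (le : I -> I -> Prop) :
  directed_set le -> ProperFilter (net_filter le).
Proof.
move=> D; apply: filter_from_proper.
  apply: filter_from_filter; first exact: directed_inhabited D.
  move=> i j _ _; have [k ik jk] := directed_ub D i j.
  by exists k => // l /= kl; split; apply: directed_trans kl.
by move=> i _; exists i; exact: (directed_refl D).
Qed.

(* The cardinality of a finite set; 0 on infinite sets. *)
Definition setcard (T : choiceType) (A : set T) : nat := #|` fset_set A |.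

Local Open Scope ring_scope.

Definition subset_net (I : Type) (M : choiceType) (F : I -> set M) : Prop :=
  forall i, F i !=set0 /\ finite_set (F i).

Definition right_folner_net (K : realType) (M : choiceType) (G : groupType)
    (R : cell_space M G) (I : Type) (le : I -> I -> Prop)
    (F : I -> set M) : Prop :=
  [/\ directed_set le, subset_net F & forall c : quot R,
    (fun i => (setcard (F i `\` (fun m => ract m c) @^-1` F i))%:R /
              (setcard (F i))%:R : K)
      @ net_filter le --> (0 : K)].

(* Main.v *)
(** A point of the [rho]-boundary of [A] lies within distance [rho] of some
    [n \in A] that is within distance [2 rho] of a point outside [A].  Measured
    from [n], the boundary point and the outside point are translates of
    elements of the balls of radius [rho] and [2 rho], so the boundary is
    covered by finitely many images, independently of [A], of sets
    [A \ (_ <| c)^-1 A].  Conversely, [A \ (_ <| c)^-1 A] is contained in the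
    [rho]-boundary as soon as [c] belongs to the ball of radius [rho]. *)

Require Import Defs.
From mathcomp Require Import all_boot all_order all_algebra finmap.
From mathcomp Require Import all_classical all_reals all_analysis.
Import GRing.Theory Num.Theory.
Import numFieldNormedType.Exports.
Local Open Scope classical_set_scope.
Local Open Scope ring_scope.

Lemma setcard_sub (T : choiceType) (A B : set T) :
  finite_set B -> A `<=` B -> (setcard A <= setcard B)%N.
Proof.
move=> finB AB; apply: fsubset_leq_card.
by rewrite -fset_set_sub //; exact: sub_finite_set finB.
Qed.

Lemma setcard_image (T U : choiceType) (f : T -> U) (A : set T) :
  finite_set A -> (setcard (f @` A) <= setcard A)%N.
Proof.
move=> finA; rewrite /setcard fset_set_image //.
exact: leq_imfset_card.
Qed.

Lemma setcard_bigcup (T U : choiceType) (D : set T) (A : T -> set U) :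
  finite_set D -> (forall d, finite_set (A d)) ->
  (setcard (\bigcup_(d in D) A d) <= \sum_(d <- fset_set D) setcard (A d))%N.
Proof.
move=> finD finA; rewrite -bigsetU_fset_set //.
(* Finiteness of the partial unions is carried through the induction, because [fset_setU] needs both
   sets finite. *)
apply: (@proj2 (finite_set (\big[setU/set0]_(d <- fset_set D) A d))).
elim/big_rec2: _ => [|d n B _ [finB le_n]].
  by rewrite /setcard fset_set0 cardfs0.
split; first by rewrite finite_setU.
rewrite /setcard fset_setU // cardfsU (leq_trans (leq_subr _ _)) //.
by rewrite leq_add2l.
Qed.

Lemma cvg_sum0 (K : realType) (T : Type) (X : set_system T) (I : Type)
    (r : seq I) (f : I -> T -> K) : Filter X ->
  (forall i, f i @ X --> (0 : K)) ->
  (fun t => \sum_(i <- r) f i t) @ X --> (0 : K).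
Proof.
(* The limit 0 is written as a sum of zeros over [r], so that [cvg_big] applies term by term. *)
move=> FX f0; rewrite -[X in _ --> X](@big1 K 0 +%R I r xpredT (fun=> 0)) //.
by apply: cvg_big => //; exact: add_continuous.
Qed.

Section CellSpaceMetric.
Context {M : choiceType} {G : groupType} {R : cell_space M G}.
Context {S : set (quot R)} (finS : finite_set S) (genS : right_generating S).
Context (symS : symmetric_set S).

(** The identification of [M] with G/G_0 turns right translation into a left action, under which the
    metric is invariant. *)
Lemma ract_transporter (m m' : M) :
  ract m (transporter R m') = Defs.act R (Defs.coord R m) m'.
Proof.
have -> : transporter R m' = Defs.coset R (Defs.coord R m').
  by apply: val_inj; apply/seteqP; split=> g /=; rewrite lcosetP coordP.
by rewrite ract_coset actM coordP.
Qed.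

Lemma ract_transporterV (m m' : M) :
  ract m (transporter R (Defs.act R (Defs.coord R m)^-1%g m')) = m'.
Proof. by rewrite ract_transporter -actM mulgV act1. Qed.

Lemma S_metric_walk (m m' : M) : walk S (S_metric S m m') m m'.
Proof. by have [] := S_metricP (walk_connected m m' genS symS). Qed.

Lemma S_metric_le (k : nat) (m m' : M) :
  walk S k m m' -> (S_metric S m m' <= k)%N.
Proof. by have [_] := S_metricP (walk_connected m m' genS symS); apply. Qed.

Lemma S_metricxx (m : M) : S_metric S m m = 0%N.
Proof. by apply/eqP; rewrite -leqn0; apply/S_metric_le/walk0. Qed.

Lemma S_metric_sym (m m' : M) : (S_metric S m m' <= S_metric S m' m)%N.
Proof.
by apply/S_metric_le/walk_sym => //; [exact: genS.1|exact: S_metric_walk].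
Qed.

Lemma S_metric_triangle (a b c : M) :
  (S_metric S a c <= S_metric S a b + S_metric S b c)%N.
Proof. by apply/S_metric_le/walk_cat; exact: S_metric_walk. Qed.

(** Since [S] is stable under G_0, the group maps walks to walks of the same length. Used for [g]
    and its inverse, this gives invariance. *)
Lemma S_metric_act (g : G) (m m' : M) :
  (S_metric S (Defs.act R g m) (Defs.act R g m') <= S_metric S m m')%N.
Proof.
by apply/S_metric_le/walk_equiv; [exact: genS.1|exact: S_metric_walk].
Qed.

Lemma S_metric_ract (m m' : M) :
  (S_metric S m (ract m (transporter R m')) <= S_metric S (origin R) m')%N.
Proof.
by rewrite ract_transporter -{1}(coordP R m); exact: S_metric_act.
Qed.

(** The inverse coordinate of [m] moves [m] to the origin without increasing distances. *)
Lemma ball_coordV (k : nat) (m m' : M) :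
  (S_metric S m m' <= k)%N ->
  Defs.ball S k (Defs.act R (Defs.coord R m)^-1%g m').
Proof.
by apply: leq_trans; rewrite -(act_coordV R m); exact: S_metric_act.
Qed.

Lemma ball_finite (k : nat) : finite_set (Defs.ball S k).
Proof.
apply: (@sub_finite_set _ _
  (\bigcup_(j in `I_k.+1) [set m | walk S j (origin R) m])); last first.
  by apply: bigcup_finite => [|j _]; [exact: finite_II|exact: walk_finite].
move=> m mk; exists (S_metric S (origin R) m); first by rewrite /= ltnS.
exact: S_metric_walk.
Qed.

Lemma ract_exit_sub_boundary (c : quot R) :
  exists rho, forall A : set M,
    A `\` (fun m => ract m c) @^-1` A `<=` boundary S rho A.
Proof.
have [g ->] := cosetS c; set m' := Defs.act R g (origin R).
have -> : Defs.coset R g = transporter R m'.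
  by apply: val_inj; apply/seteqP; split=> h /=; rewrite lcosetP.
(* The radius depends on [c] only: it is the distance from the origin to the point identified with
   [c]. *)
exists (S_metric S (origin R) m') => A m [Am nAm]; split.
  (* Translating [m] by the origin, which lies in every ball, gives back [m]; so [m] is in the
     dilation. *)
  exists m; split=> //; exists (origin R).
    by rewrite /Defs.ball /= S_metricxx.
  by rewrite ract_transporter coordP.
by move=> ero; apply: nAm; apply: ero; exists m'; rewrite /Defs.ball /=.
Qed.

Lemma boundary_sub_ract (rho : nat) (A : set M) :
  boundary S rho A `<=`
  \bigcup_(b in Defs.ball S rho) \bigcup_(c in Defs.ball S (rho + rho))
    (fun n => ract n (transporter R b)) @`
      (A `\` (fun n => ract n (transporter R c)) @^-1` A).
Proof.
move=> m [[n [[b bB bn] An]]] /existsNP[p /not_implyP[[c cB cp] nAp]].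
have nm : (S_metric S n m <= rho)%N.
  apply: leq_trans (S_metric_sym _ _) _.
  by rewrite -bn; apply: leq_trans (S_metric_ract _ _) bB.
have np : (S_metric S n p <= rho + rho)%N.
  apply: leq_trans (S_metric_triangle n m p) (leq_add nm _).
  by rewrite -cp; apply: leq_trans (S_metric_ract _ _) cB.
(* Pulled back along the coordinate of [n], the points [m] and [p] become the ball elements that
   translate [n] to them. *)
exists (Defs.act R (Defs.coord R n)^-1%g m); first exact: ball_coordV.
exists (Defs.act R (Defs.coord R n)^-1%g p); first exact: ball_coordV.
by exists n; [split=> //=|]; rewrite ract_transporterV.
Qed.

(** Taking an image cannot raise the cardinality, so the summand is free of [b]. The index sets do
    not depend on [A], so the bound passes to the limit. *)
Lemma boundary_card_le (rho : nat) (A : set M) : finite_set A ->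
  (setcard (boundary S rho A) <=
    \sum_(b <- fset_set (Defs.ball S rho))
      \sum_(c <- fset_set (Defs.ball S (rho + rho)))
        setcard (A `\` (fun n => ract n (transporter R c)) @^-1` A))%N.
Proof.
move=> finA; have finD c : finite_set
    (A `\` (fun n => ract n (transporter R c)) @^-1` A) by exact: finite_setD.
have finB b : finite_set (\bigcup_(c in Defs.ball S (rho + rho))
    (fun n => ract n (transporter R b)) @`
      (A `\` (fun n => ract n (transporter R c)) @^-1` A)).
  by apply: bigcup_finite => [|c _]; [exact: ball_finite|exact: finite_image].
apply: leq_trans (setcard_sub _ _ _ _ (boundary_sub_ract rho A)) _.
  by apply: bigcup_finite => //; exact: ball_finite.
apply: leq_trans (setcard_bigcup _ _ _ _ (ball_finite _) finB) _.
apply: leq_sum => b _.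
apply: leq_trans (setcard_bigcup _ _ _ _ (ball_finite _) _) _.
  by move=> c; exact: finite_image.
by apply: leq_sum => c _; exact: setcard_image.
Qed.

End CellSpaceMetric.

Theorem theorem10p6 (K : realType) (M : choiceType) (G : groupType)
    (R : cell_space M G) (hR : finitely_right_generated R)
    (hG0 : finite_set (stab R))
    (S : set (quot R)) (finS : finite_set S) (genS : right_generating S)
    (symS : symmetric_set S)
    (I : Type) (le : I -> I -> Prop) (hI : directed_set le)
    (F : I -> set M) (hF : subset_net F) :
  right_folner_net K R le F <->
  forall rho : nat,
    (fun i => (setcard (boundary S rho (F i)))%:R / (setcard (F i))%:R : K)
      @ net_filter le --> (0 : K).
Proof.
have PF := net_filter_proper hI; have FF : Filter (net_filter le) by exact: PF.
have cvg_le (f g : I -> K) : (forall i, 0 <= f i <= g i) ->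
    g @ net_filter le --> (0 : K) -> f @ net_filter le --> (0 : K).
  by move=> fg; apply: squeeze_cvgr (cvg_cst _); exact: nearW.
split=> [[_ _ folF] rho|bF].
  (* The balls are the same for all [i], so this is a fixed finite sum of nets tending to 0. *)
  apply: cvg_le (cvg_sum0 K I _ M (fset_set (Defs.ball S rho)) _ FF
    (fun b => cvg_sum0 K I _ M (fset_set (Defs.ball S (rho + rho))) _ FF
      (fun c => folF (transporter R c)))) => i.
  rewrite divr_ge0 //=.
  under [X in _ <= X]eq_bigr => b _ do rewrite -mulr_suml -natr_sum.
  rewrite -mulr_suml -natr_sum ler_wpM2r ?invr_ge0 // ler_nat.
  by apply: boundary_card_le => //; exact: (hF i).2.
split=> // c; have [rho sub] := ract_exit_sub_boundary genS symS c.
apply: cvg_le (bF rho) => i; rewrite divr_ge0 //=.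
rewrite ler_wpM2r ?invr_ge0 // ler_nat.
(* Monotonicity needs a finite boundary, as [setcard] is 0 on infinite sets. *)
apply: setcard_sub (sub (F i)).
by apply: boundary_finite => //; exact: (hF i).2.
Qed.
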